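(* Let $\mathbf{f}$ be the Fibonacci word, and for $n\ge1$ let $h(n)=\lfloor (n+1)\alpha\rfloor-\lfloor\alpha\rfloor$. Let $\mathbf{f}[1,n]$ denote the prefix of length $n$ of $\mathbf f$. If $|\mathbf{f}[1,n]|_0$ is odd, then \[\psi(T(0\mathbf f[1,n]))=\psi(\overline T(0\mathbf f[1,n]))=\left(\tfrac{n-h(n)}{2}+\tfrac12,\ h(n),\ \tfrac{n-h(n)}{2}+\tfrac12\right),\] \[\psi(T(1\mathbf f[1,n]))=\left(\tfrac{n-h(n)}{2}+\tfrac12,\ h(n)+1,\ \tfrac{n-h(n)}{2}-\tfrac12\right),\quad \psi(\overline T(1\mathbf f[1,n]))=\left(\tfrac{n-h(n)}{2}-\tfrac12,\ h(n)+1,\ \tfrac{n-h(n)}{2}+\tfrac12\right).\] If $|\mathbf f[1,n]|_0$ is even, then \[\psi(T(0\mathbf f[1,n]))=\left(\tfrac{n-h(n)}{2}+1,\ h(n),\ \tfrac{n-h(n)}{2}\right),\quad \psi(\overline T(0\mathbf f[1,n]))=\left(\tfrac{n-h(n)}{2},\ h(n),\ \tfrac{n-h(n)}{2}+1\right),\] \[\psi(T(1\mathbf f[1,n]))=\psi(\overline T(1\mathbf f[1,n]))=\left(\tfrac{n-h(n)}{2},\ h(n)+1,\ \tfrac{n-h(n)}{2}\right).\]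
   Context: $\varphi=(1+\sqrt5)/2$, $\alpha=2-\varphi$, $\mathbf{f}=(\lfloor (n+1)\alpha\rfloor-\lfloor n\alpha\rfloor)_{n\ge1}$. For a finite word over $\{0,1\}$, $T$ keeps each $1$ and replaces the 2nd, 4th, 6th, $\dots$ occurrences of $0$ by $2$; $\overline T$ keeps each $1$ and replaces the 1st, 3rd, 5th, $\dots$ occurrences of $0$ by $2$. For a word $u$ over $\{0,1,2\}$, $\psi(u)=(|u|_0,|u|_1,|u|_2)$ where $|u|_c$ is the number of occurrences of $c$ in $u$. *)

(* Defs.v *)
From HB Require Import structures.
From mathcomp Require Import all_boot all_order all_algebra.
From mathcomp Require Import reals.

Set Implicit Arguments.
Unset Strict Implicit.
Unset Printing Implicit Defensive.

Import Order.TTheory GRing.Theory Num.Theory.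
Local Open Scope ring_scope.

Section FibonacciWord.
Variable R : realType.

Definition phi : R := (1 + Num.sqrt 5) / 2.

Definition alpha : R := 2 - phi.

(* Letters are integers, so that the difference of floors below is itself a
   letter; it only takes the values 0 and 1. *)
Definition fib (n : nat) : int :=
  Num.floor (n.+1%:R * alpha) - Num.floor (n%:R * alpha).

(* f[1,n]: the word f is indexed from 1. *)
Definition fib_prefix (n : nat) : seq int := [seq fib i | i <- iota 1 n].

Definition h (n : nat) : int :=
  Num.floor (n.+1%:R * alpha) - Num.floor alpha.

End FibonacciWord.

Definition occ (c : int) (u : seq int) : nat := count_mem c u.

(* If position i of w (counted from 0) carries a 0, it is the k-th occurrence
   of 0 in w, where k = zero_rank w i >= 1. *)
Definition zero_rank (w : seq int) (i : nat) : nat := occ 0 (take i.+1 w).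

(* T and Tbar are meant for words over {0,1}. *)
Definition T (w : seq int) : seq int :=
  mkseq (fun i => if (w`_i == 0) && ~~ odd (zero_rank w i) then 2 else w`_i)
        (size w).

Definition Tbar (w : seq int) : seq int :=
  mkseq (fun i => if (w`_i == 0) && odd (zero_rank w i) then 2 else w`_i)
        (size w).

Definition psi (u : seq int) : nat * nat * nat := (occ 0 u, occ 1 u, occ 2 u).

Definition triple_to_rat (v : nat * nat * nat) : rat * rat * rat :=
  (v.1.1%:R, v.1.2%:R, v.2%:R).

(* Main.v *)
Require Import Defs.
From HB Require Import structures.
From mathcomp Require Import all_boot all_order all_algebra.
From mathcomp Require Import reals.
From mathcomp Require Import zify ring lra.

Set Implicit Arguments.
Unset Strict Implicit.
Unset Printing Implicit Defensive.

Import Order.TTheory GRing.Theory Num.Theory.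
Local Open Scope ring_scope.

(** Only the numbers of 0s and 1s in a binary word matter. Alternate 0s become 2, so among m zeros
    [T] keeps the larger half (rounded up) and [Tbar] the smaller, while the 1s are untouched
    ([psi_mark]). The letters of f[1,n] are 0 or 1 ([fib_binary]), so their sum counts the 1s
    ([count_binary]); being differences of consecutive floors, they telescope to h(n)
    ([sum_fib_prefix]). Hence f[1,n] has h(n) ones and n - h(n) zeros, a prepended letter adds one
    to either count, and the parity of the zeros settles the rounding. *)

(* [T] and [Tbar] at once: [T] is [mark true] and [Tbar] is [mark false], up to
   conversion. *)
Definition mark (b : bool) (w : seq int) : seq int :=
  mkseq (fun i => if (w`_i == 0) && (b (+) odd (zero_rank w i)) then 2 else w`_i)
        (size w).

(** Ranks are counted from the left, so appending a letter leaves earlier ranks alone, whereas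
    prepending a 0 would shift them all. This is why the induction in [psi_mark] runs from the
    right. *)
Lemma mark_rcons b w x :
  mark b (rcons w x) =
  rcons (mark b w) (if (x == 0) && (b (+) ~~ odd (occ 0 w)) then 2 else x).
Proof.
rewrite /mark size_rcons mkseqS nth_rcons ltnn eqxx /zero_rank.
have -> : take (size w).+1 (rcons w x) = rcons w x.
  by rewrite take_oversize // size_rcons.
congr (rcons _ _).
  apply/eq_in_map => i; rewrite mem_iota add0n => /andP[_ lt_iw].
  by rewrite nth_rcons lt_iw -cats1 takel_cat.
(* An appended 0 counts itself: its rank is [occ 0 w] plus one, whence the negated parity. *)
by case: eqP => [->|//]; rewrite /occ -cats1 count_cat /= addn0 addn1.
Qed.

Lemma psi_mark b w : {subset w <= [:: 0; 1]} ->
  psi (mark b w) = ((b + occ 0 w)./2, occ 1 w, (~~ b + occ 0 w)./2).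
Proof.
elim/last_ind: w => [|w x IHw] sub01; first by case: b.
have /IHw{IHw} : {subset w <= [:: 0; 1]}.
  by move=> y yw; apply: sub01; rewrite mem_rcons inE yw orbT.
have : x \in [:: 0; 1] by apply: sub01; rewrite mem_rcons mem_head.
rewrite mark_rcons /psi /occ -!cats1 !count_cat /= !inE.
move=> /orP[]/eqP-> [-> -> ->]; last by rewrite /= !addn0.
by case: b => /=; set m := count _ _; case: ifP => ? /=; congr (_, _, _); lia.
Qed.

Lemma count_binary (w : seq int) : {subset w <= [:: 0; 1]} ->
  (occ 0 w + occ 1 w)%N = size w /\ (occ 1 w)%:Z = \sum_(x <- w) x.
Proof.
elim: w => [|x w IHw] sub01; first by rewrite big_nil.
have /IHw{IHw} [sz one] : {subset w <= [:: 0; 1]}.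
  by move=> y yw; apply: sub01; rewrite inE yw orbT.
have : x \in [:: 0; 1] by apply: sub01; rewrite mem_head.
rewrite big_cons /occ /= !inE => /orP[]/eqP->; rewrite -sz -one /= add0n.
  by rewrite add0r.
by rewrite addnCA PoszD.
Qed.

Section FibonacciPrefix.
Variable R : realType.

(** Since alpha = (3 - sqrt 5) / 2, this amounts to 1 <= sqrt 5 <= 3. *)
Lemma alpha_itv : 0 <= alpha R <= 1.
Proof.
have s0 : 0 <= Num.sqrt (5 : R) := sqrtr_ge0 _.
have s2 : Num.sqrt (5 : R) ^+ 2 = 5 by rewrite sqr_sqrtr.
have lo : 1 <= Num.sqrt (5 : R) by nra.
have hi : Num.sqrt (5 : R) <= 3 by nra.
by rewrite /alpha /phi; lra.
Qed.

(** A step of length alpha in [0, 1] raises the floor by 0 or 1. *)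
Lemma fib_binary n : fib R n \in [:: 0; 1].
Proof.
have /andP[a0 a1] := alpha_itv.
have -> : fib R n = Num.floor (n%:R * alpha R + alpha R) - Num.floor (n%:R * alpha R).
  by rewrite /fib -natr1 mulrDl mul1r.
set x := _ * _.
have lo : Num.floor x <= Num.floor (x + alpha R) by apply: le_floor; lra.
have hi : Num.floor (x + alpha R) <= Num.floor x + 1.
  by rewrite -(floor1 R) -floorDrz // le_floor //; lra.
by rewrite !inE; lia.
Qed.

Lemma fib_prefix_binary n : {subset fib_prefix R n <= [:: 0; 1]}.
Proof. by move=> _ /mapP[i _ ->]; exact: fib_binary. Qed.

Lemma sum_fib_prefix n : \sum_(x <- fib_prefix R n) x = h R n.
Proof.
(* Writing alpha as 1 * alpha makes its floor the lower end of the telescoping sum. *)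
rewrite /fib_prefix big_map /h -{2}[alpha R]mul1r.
have -> : iota 1 n = index_iota 1 n.+1 by rewrite /index_iota subn1.
by rewrite (telescope_sumr (fun i => Num.floor (i%:R * alpha R))).
Qed.

End FibonacciPrefix.

Theorem theorem15 (R : realType) (n : nat) (hn : (1 <= n)%N) :
  let w := fib_prefix R n in
  let H : rat := (h R n)%:~R in
  let q : rat := (n%:R - H) / 2 in
  (odd (occ 0 w) ->
    [/\ triple_to_rat (psi (T (0 :: w))) = (q + 1 / 2, H, q + 1 / 2),
        triple_to_rat (psi (Tbar (0 :: w))) = (q + 1 / 2, H, q + 1 / 2),
        triple_to_rat (psi (T (1 :: w))) = (q + 1 / 2, H + 1, q - 1 / 2)
      & triple_to_rat (psi (Tbar (1 :: w))) = (q - 1 / 2, H + 1, q + 1 / 2)])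
  /\
  (~~ odd (occ 0 w) ->
    [/\ triple_to_rat (psi (T (0 :: w))) = (q + 1, H, q),
        triple_to_rat (psi (Tbar (0 :: w))) = (q, H, q + 1),
        triple_to_rat (psi (T (1 :: w))) = (q, H + 1, q)
      & triple_to_rat (psi (Tbar (1 :: w))) = (q, H + 1, q)]).
Proof.
move=> w H q.
have w01 : {subset w <= [:: 0; 1]} := @fib_prefix_binary R n.
have [sz one] := count_binary w01.
have HE : H = (occ 1 w)%:R by rewrite /H -sum_fib_prefix -one.
have qE : q = (occ 0 w)%:R / 2.
  (* Here n is read as the length of w, that is zeros plus ones, and the ones cancel against H. *)
  by rewrite /q HE -[n in n%:R](size_iota 1) -(size_map (fib R)) -sz natrD addrK.
have sub a : a \in [:: 0; 1] -> {subset a :: w <= [:: 0; 1]}.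
  by move=> a01 x; rewrite inE => /predU1P[->//|/w01].
have p0 b := psi_mark b (sub 0 isT).
have p1 b := psi_mark b (sub 1 isT).
rewrite -[T]/(mark true) -[Tbar]/(mark false) !p0 !p1 qE HE /triple_to_rat /occ /=.
set m := count_mem 0 w; set k := count_mem 1 w; rewrite !add0n add1n.
(* All rounded halves are now [m./2] or [uphalf m], up to a successor; each parity of m expresses
   them through j alone. *)
have := odd_double_half m; set j := m./2 => jE.
split=> [modd | /negPf meven].
  have mE : m = j.*2.+1 by rewrite -jE modd.
  have -> : uphalf m = j.+1 by lia.
  have mR : m%:R = j%:R * 2 + 1 :> rat by rewrite mE -natr1 -muln2 natrM.
  by rewrite mR -!natr1; split; congr (_, _, _); field.
have mE : m = j.*2 by rewrite -jE meven.
have -> : uphalf m = j by lia.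
have mR : m%:R = j%:R * 2 :> rat by rewrite mE -muln2 natrM.
by rewrite mR -!natr1; split; congr (_, _, _); field.
Qed.
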